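(* Define the map $\Phi$ on nonzero rational functions in $z$ by $\Phi(f(z))=\frac{1}{f(1/z)}$. Then $\Phi^2=\mathrm{id}$. Moreover, for every positive integer $n$ and every $j=1,\dots,2^n$, \[ \Phi(w_{n,j})(z)=w_{n,2^n-j+1}(z). \]
   Context: Let $z$ be a variable. A positive linear fractional transformation is an expression $w=\frac{az+b}{cz+d}$ with $a,b,c,d\in\mathbb{N}_0=\{0,1,2,\dots\}$ and $ad-bc\neq0$. Define $\frac{w}{w+1}:=\frac{az+b}{(a+c)z+(b+d)}$ and $w+1:=\frac{(a+c)z+(b+d)}{cz+d}$. The rows are defined recursively. Row $0$ is $(w_{0,1})=(z)$. For $n\ge1$, row $n$ is $(w_{n,1}(z),\dots,w_{n,2^n}(z))$, with $w_{n,2i-1}=\frac{w_{n-1,i}}{w_{n-1,i}+1}$ and $w_{n,2i}=w_{n-1,i}+1$ for $i=1,\dots,2^{n-1}$. *)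

(* Defs.v *)
From HB Require Import structures.
From mathcomp Require Import all_boot all_order all_algebra.
From mathcomp Require Import fraction generic_quotient.

Set Implicit Arguments.
Unset Strict Implicit.
Unset Printing Implicit Defensive.

Import GRing.Theory.
Local Open Scope ring_scope.
Local Open Scope quotient_scope.

Notation ratfun F := {fraction {poly F}}.

Definition ratvar (F : fieldType) : ratfun F := FracField.tofrac 'X.

Definition ratpoly_at (F : fieldType) (p : {poly F}) (g : ratfun F) : ratfun F :=
  (map_poly (@FracField.tofrac {poly F} \o polyC) p).[g].

(* f(1/z). It is computed on a chosen representative num/den of f; by
   [at_invE] below the result does not depend on this choice. *)
Definition at_inv (F : fieldType) (f : ratfun F) : ratfun F :=
  ratpoly_at \n_(repr f) (ratvar F)^-1 / ratpoly_at \d_(repr f) (ratvar F)^-1.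

(* Meant for f != 0, see [Phi_neq0]; the convention 0^-1 = 0 gives Phi 0 = 0. *)
Definition Phi (F : fieldType) (f : ratfun F) : ratfun F := (at_inv f)^-1.

(* A formal expression (a z + b) / (c z + d), not a rational function: it is
   determined by its coefficients a, b, c, d. *)
Record plft := PLFT {
  plft_a : nat;
  plft_b : nat;
  plft_c : nat;
  plft_d : nat;
  plft_det : (plft_a * plft_d)%N != (plft_b * plft_c)%N
}.

Lemma plft_z_det : (1 * 1)%N != (0 * 0)%N. Proof. by []. Qed.
Definition plft_z : plft := PLFT plft_z_det.

Lemma plft_left_det (w : plft) :
  (plft_a w * (plft_b w + plft_d w))%N != (plft_b w * (plft_a w + plft_c w))%N.
Proof.
by case: w => a b c d /= h; rewrite !mulnDr [(b * a)%N]mulnC eqn_add2l.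
Qed.

(* w / (w + 1) *)
Definition plft_left (w : plft) : plft := PLFT (plft_left_det w).

Lemma plft_right_det (w : plft) :
  ((plft_a w + plft_c w) * plft_d w)%N != ((plft_b w + plft_d w) * plft_c w)%N.
Proof.
by case: w => a b c d /= h; rewrite !mulnDl [(d * c)%N]mulnC eqn_add2r.
Qed.

(* w + 1 *)
Definition plft_right (w : plft) : plft := PLFT (plft_right_det w).

(* w_{n,j}, with j counted from 1: both j = 2i - 1 and j = 2i have uphalf j = i.
   Values at j = 0 and j > 2^n are meaningless. *)
Fixpoint row_entry (n j : nat) : plft :=
  if n is m.+1 then
    let w := row_entry m (uphalf j) in
    if odd j then plft_left w else plft_right w
  else plft_z.

Definition plft_ratfun (F : fieldType) (w : plft) : ratfun F :=
  ((plft_a w)%:R * ratvar F + (plft_b w)%:R) /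
  ((plft_c w)%:R * ratvar F + (plft_d w)%:R).

Lemma row_entry0 : row_entry 0 1 = plft_z. Proof. by []. Qed.

Lemma row_entry_odd n i : (0 < n)%N -> (1 <= i <= 2 ^ n.-1)%N ->
  row_entry n (2 * i - 1) = plft_left (row_entry n.-1 i).
Proof.
case: n => // n _ /andP[i1 _]; case: i i1 => // i _.
by rewrite mul2n doubleS subn1 /= odd_double /= doubleK.
Qed.

Lemma row_entry_even n i : (0 < n)%N -> (1 <= i <= 2 ^ n.-1)%N ->
  row_entry n (2 * i) = plft_right (row_entry n.-1 i).
Proof. by case: n => // n _ _; rewrite mul2n /= odd_double uphalf_double. Qed.

Section WellDefined.
Variable F : fieldType.
Local Notation tofrac := (@FracField.tofrac {poly F}).

Lemma ratvar_neq0 : ratvar F != 0.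
Proof. by rewrite tofrac_eq0 polyX_eq0. Qed.

Lemma ratpoly_atM (p q : {poly F}) g :
  ratpoly_at (p * q) g = ratpoly_at p g * ratpoly_at q g.
Proof. by rewrite /ratpoly_at rmorphM hornerM. Qed.

Lemma ratpoly_at_inv_neq0 (q : {poly F}) :
  q != 0 -> ratpoly_at q (ratvar F)^-1 != 0.
Proof.
move=> q0; set m := (size q).-1.
have sq : size q = m.+1 by rewrite /m prednK // lt0n size_poly_eq0.
suff E : ratvar F ^+ m * ratpoly_at q (ratvar F)^-1 =
    tofrac (\sum_(i < m.+1) q`_i *: 'X^(m - i)).
  suff : ratvar F ^+ m * ratpoly_at q (ratvar F)^-1 != 0.
    by rewrite mulf_eq0 negb_or => /andP[].
  rewrite E tofrac_eq0; apply/negP => /eqP/(congr1 (fun p : {poly F} => p`_0)).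
  rewrite coef0 coef_sum big_ord_recr /= big1 => [|i _].
    rewrite subnn coefZ expr0 coef1 mulr1 add0r => /eqP.
    by rewrite -lead_coefE lead_coef_eq0 (negPf q0).
  rewrite coefZ coefXn (_ : (0 == m - i)%N = false) ?mulr0 //.
  by apply/negbTE; rewrite eq_sym -lt0n subn_gt0.
rewrite /ratpoly_at (horner_coef_wide (n := m.+1)); last first.
  by rewrite -sq; apply: size_poly.
rewrite mulr_sumr rmorph_sum /=; apply: eq_bigr => i _.
rewrite coef_map_id0 ?rmorph0 //= -mul_polyC rmorphM /= mulrCA; congr (_ * _).
rewrite rmorphXn /= -/(ratvar F) exprVn.
by rewrite -expfB_cond ?(negPf ratvar_neq0) ?add0n // -ltnS ltn_ord.
Qed.

Lemma ratfun_repr (f : ratfun F) : f = tofrac \n_(repr f) / tofrac \d_(repr f).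
Proof.
have d0 := denom_ratioP (repr f).
apply: (mulIf (x := tofrac \d_(repr f))); first by rewrite tofrac_eq0.
rewrite divfK ?tofrac_eq0 //.
have T (y : {poly F}) : tofrac y = \pi_(ratfun F) (Ratio y 1) by rewrite piE.
rewrite -{1}[f]reprK !T; set x := repr f in d0 *.
change (FracField.mul (\pi_(ratfun F) x) (\pi_(ratfun F) (Ratio \d_x 1)) =
  \pi_(ratfun F) (Ratio \n_x 1)).
rewrite -FracField.pi_mul; apply/eqmodP => /=.
rewrite FracField.equivfE /FracField.mulf.
by rewrite !numden_Ratio ?mulr1 ?oner_eq0 ?mulf_neq0 // mulrC.
Qed.

Lemma at_invE (p q : {poly F}) : q != 0 ->
  at_inv (tofrac p / tofrac q) =
  ratpoly_at p (ratvar F)^-1 / ratpoly_at q (ratvar F)^-1.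
Proof.
move=> q0; rewrite /at_inv; set f := tofrac p / tofrac q.
have d0 := denom_ratioP (repr f).
apply/eqP; rewrite eqr_div ?ratpoly_at_inv_neq0 // -!ratpoly_atM; apply/eqP.
congr (ratpoly_at _ _); apply/eqP; rewrite -tofrac_eq !tofracM.
rewrite -eqr_div ?tofrac_eq0 //.
by rewrite -ratfun_repr.
Qed.

Lemma Phi_neq0 (f : ratfun F) : f != 0 -> Phi f != 0.
Proof.
move=> f0; have d0 := denom_ratioP (repr f).
rewrite /Phi /at_inv invr_eq0 mulf_neq0 ?invr_eq0 ?ratpoly_at_inv_neq0 //.
by apply: contraNneq f0 => n0; rewrite [f]ratfun_repr n0 tofrac0 mul0r.
Qed.

Lemma plft_lin_neq0 (a b : nat) : [pchar F] =i pred0 ->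
  (a != 0%N) || (b != 0%N) -> a%:R * ratvar F + b%:R != 0.
Proof.
move=> /pcharf0P F0 ab.
have -> : a%:R * ratvar F + b%:R = tofrac (a%:R%:P * 'X + b%:R%:P).
  by rewrite !polyC_natr rmorphD rmorphM !rmorph_nat.
rewrite tofrac_eq0.
apply/negP => /eqP E; move: ab.
have := congr1 (fun p : {poly F} => p`_1) E.
have := congr1 (fun p : {poly F} => p`_0) E.
rewrite !coefD !coefMX !coefC /= add0r addr0 => /eqP; rewrite F0 => ->.
by move/eqP; rewrite F0 => ->.
Qed.

Lemma plft_den_neq0 (w : plft) : [pchar F] =i pred0 ->
  (plft_c w)%:R * ratvar F + (plft_d w)%:R != 0.
Proof.
move=> F0; apply: plft_lin_neq0 => //; case: w => a b [|c] [|d] //=.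
by rewrite !muln0.
Qed.

Lemma plft_ratfun_neq0 (w : plft) : [pchar F] =i pred0 -> plft_ratfun F w != 0.
Proof.
move=> F0; rewrite mulf_neq0 ?invr_eq0 ?plft_den_neq0 //.
by apply: plft_lin_neq0 => //; case: w => [[|a]] [|b] c d.
Qed.

End WellDefined.

(* Main.v *)
Require Import Defs.
From mathcomp Require Import all_boot all_order all_algebra.
From mathcomp Require Import fraction.
From mathcomp Require Import zify.

Import GRing.Theory.
Local Open Scope ring_scope.

(** Substituting 1/z for z is a field endomorphism of F(z) exchanging z and
    1/z, hence an involution; as it commutes with inversion, Phi is an
    involution too.  Phi sends (a z + b) / (c z + d) to (d z + c) / (b z + a),
    and this reversal of the coefficients exchanges w / (w + 1) with the
    successor of the reversal of w, so by induction it reverses each row. *)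

Section SubstInv.
Variable F : fieldType.
Local Notation tofrac := (@FracField.tofrac {poly F}).
Local Notation z := (ratvar F).

Lemma ratpoly_atD (p q : {poly F}) g :
  ratpoly_at (p + q) g = ratpoly_at p g + ratpoly_at q g.
Proof. by rewrite /ratpoly_at rmorphD hornerD. Qed.

Lemma ratpoly_atC (c : F) g : ratpoly_at c%:P g = tofrac c%:P.
Proof. by rewrite /ratpoly_at map_polyC hornerC. Qed.

Lemma ratpoly_atX g : ratpoly_at ('X : {poly F}) g = g.
Proof. by rewrite /ratpoly_at map_polyX hornerX. Qed.

Lemma ratpoly_at_var (p : {poly F}) : ratpoly_at p z = tofrac p.
Proof.
elim/poly_ind: p => [|p c IHp]; first exact: ratpoly_atC.
by rewrite ratpoly_atD ratpoly_atM ratpoly_atC ratpoly_atX IHp rmorphD rmorphM.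
Qed.

(** [at_inv] is defined on a chosen representative; with f written as an arbitrary fraction,
    [at_invE] computes it on sums, products and inverses. *)
Lemma ratfunP (f : ratfun F) :
  exists p q : {poly F}, q != 0 /\ f = tofrac p / tofrac q.
Proof.
exists \n_(repr f), \d_(repr f).
by split; [apply: denom_ratioP | apply: ratfun_repr].
Qed.

Lemma at_inv_tofrac (p : {poly F}) : at_inv (tofrac p) = ratpoly_at p z^-1.
Proof.
rewrite -[tofrac p]divr1 -(tofrac1 {poly F}) at_invE ?oner_eq0 //.
by rewrite ratpoly_atC tofrac1 divr1.
Qed.

Lemma at_invM (f g : ratfun F) : at_inv (f * g) = at_inv f * at_inv g.
Proof.
have [p [q [q0 ->]]] := ratfunP f; have [r [s [s0 ->]]] := ratfunP g.
by rewrite mulf_div -!tofracM !at_invE ?mulf_neq0 // !ratpoly_atM mulf_div.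
Qed.

Lemma at_invD (f g : ratfun F) : at_inv (f + g) = at_inv f + at_inv g.
Proof.
have [p [q [q0 ->]]] := ratfunP f; have [r [s [s0 ->]]] := ratfunP g.
rewrite addf_div ?tofrac_eq0 // -!tofracM -tofracD !at_invE ?mulf_neq0 //.
by rewrite addf_div ?ratpoly_at_inv_neq0 // ratpoly_atD !ratpoly_atM.
Qed.

Lemma at_invV (f : ratfun F) : at_inv f^-1 = (at_inv f)^-1.
Proof.
have [p [q [q0 ->]]] := ratfunP f; have [->|p0] := eqVneq p 0.
  (* For p = 0 the inverse q / p is outside the scope of [at_invE]; both sides are 0 because 0^-1 =
     0. *)
  by rewrite tofrac0 mul0r invr0 -(tofrac0 {poly F}) at_inv_tofrac
             ratpoly_atC tofrac0 invr0.
by rewrite invf_div !at_invE // invf_div.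
Qed.

Lemma at_inv_var : at_inv z = z^-1.
Proof. by rewrite at_inv_tofrac ratpoly_atX. Qed.

Lemma at_inv_nat (n : nat) : at_inv (n%:R : ratfun F) = n%:R.
Proof.
have -> : n%:R = tofrac n%:R%:P by rewrite polyC_natr rmorph_nat.
by rewrite at_inv_tofrac ratpoly_atC.
Qed.

(** [at_inv] respects sums and products and fixes constants, so it passes through polynomial
    evaluation. *)
Lemma at_inv_ratpoly_at (p : {poly F}) g :
  at_inv (ratpoly_at p g) = ratpoly_at p (at_inv g).
Proof.
elim/poly_ind: p => [|p c IHp].
  by rewrite !ratpoly_atC at_inv_tofrac ratpoly_atC.
rewrite !ratpoly_atD !ratpoly_atM !ratpoly_atC !ratpoly_atX.
by rewrite at_invD at_invM IHp at_inv_tofrac ratpoly_atC.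
Qed.

Lemma at_invK : involutive (@at_inv F).
Proof.
move=> f; have [p [q [q0 ->]]] := ratfunP f.
(* The second substitution acts on the evaluation point only, turning 1/z back into z. *)
rewrite at_invE // at_invM at_invV !at_inv_ratpoly_at at_invV at_inv_var invrK.
by rewrite !ratpoly_at_var.
Qed.

Lemma PhiK : involutive (@Phi F).
Proof. by move=> f; rewrite /Phi at_invV invrK at_invK. Qed.

(** A relation on coefficients, rather than a map on [plft], avoids building or comparing the
    determinant proofs stored in the records. *)
Definition plft_reversed (w w' : plft) : Prop :=
  [/\ plft_a w' = plft_d w, plft_b w' = plft_c w,
      plft_c w' = plft_b w & plft_d w' = plft_a w].

Lemma Phi_plft (w w' : plft) :
  plft_reversed w w' -> Phi (plft_ratfun F w) = plft_ratfun F w'.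
Proof.
(* Numerator and denominator each acquire a factor 1/z, which cancels in the quotient. *)
have lin (a b : nat) :
    at_inv (a%:R * z + b%:R) = (b%:R * z + a%:R) / z.
  rewrite at_invD at_invM !at_inv_nat at_inv_var mulrDl mulfK ?ratvar_neq0 //.
  by rewrite addrC.
case=> Ea Eb Ec Ed; rewrite /Phi /plft_ratfun Ea Eb Ec Ed.
rewrite at_invM at_invV !lin invf_div.
by rewrite invf_div mulrA divfK ?ratvar_neq0.
Qed.

End SubstInv.

Lemma plft_reversed_left w w' :
  plft_reversed w w' -> plft_reversed (plft_left w) (plft_right w').
Proof. by case=> Ea Eb Ec Ed; split; rewrite /= ?Ea ?Eb ?Ec ?Ed // addnC. Qed.

Lemma plft_reversed_right w w' :
  plft_reversed w w' -> plft_reversed (plft_right w) (plft_left w').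
Proof. by case=> Ea Eb Ec Ed; split; rewrite /= ?Ea ?Eb ?Ec ?Ed // addnC. Qed.

Lemma row_entry_reversed (n j : nat) : (1 <= j <= 2 ^ n)%N ->
  plft_reversed (row_entry n j) (row_entry n (2 ^ n - j + 1)).
Proof.
(* In row 0, the coefficients 1, 0, 0, 1 of z are their own reversal. *)
elim: n j => [|n IHn] j j_bounds; first by [].
rewrite expnS in j_bounds *.
(* Reflecting j in row n + 1 reflects its parent index [uphalf j] in row n and flips the parity of
   j, so left and right children trade places. *)
have i_bounds : (1 <= uphalf j <= 2 ^ n)%N by lia.
have Ei : (uphalf (2 * 2 ^ n - j + 1) = 2 ^ n - uphalf j + 1)%N by lia.
have Eo : odd (2 * 2 ^ n - j + 1) = ~~ odd j by lia.
rewrite [row_entry n.+1 j]/= [row_entry n.+1 _]/= Ei Eo.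
by case: (odd j); [apply: plft_reversed_left | apply: plft_reversed_right];
  apply: IHn.
Qed.

Theorem mainTheorem5 (F : fieldType) (charF : [pchar F] =i pred0) :
  (forall f : ratfun F, f != 0 -> Phi (Phi f) = f) /\
  (forall n j : nat, (0 < n)%N -> (1 <= j <= 2 ^ n)%N ->
     Phi (plft_ratfun F (row_entry n j)) =
     plft_ratfun F (row_entry n (2 ^ n - j + 1))).
Proof.
split=> [f _ | n j _ j_bounds]; first exact: PhiK.
exact/Phi_plft/row_entry_reversed.
Qed.
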